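(* Let $\kappa>0$ be the common precision of the seller's and buyer's private signals, let $\ell>0$, $\underline u>0$, $\chi\in\mathbb R$ be fixed, and let $h(a,r)=\ell-\underline u-a-\chi r$. For public precision $\tau>0$ let $D(a,r,\tau)$ be the probability of trade, so that $$D(a,r,\tau)=\Phi\!\left(\frac{h(a,r)}{\omega(\tau)}\right),\qquad \omega(\tau)=\frac{\sqrt{2\kappa}}{\tau+\kappa}.$$ Then for any fixed $(a,r)$ with $a\ge 0$, $r\ge 0$, and every $\tau>0$, $$\operatorname{sign}\!\left(\frac{\partial D(a,r,\tau)}{\partial \tau}\right)=\operatorname{sign}\big(h(a,r)\big).$$ Moreover, as $\tau\to\infty$, $D(a,r,\tau)\to 1$ if $h(a,r)>0$, $D(a,r,\tau)\to \tfrac12$ if $h(a,r)=0$, and $D(a,r,\tau)\to 0$ if $h(a,r)<0$.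
   Context: $\Phi$ is the standard normal cumulative distribution function, and $\operatorname{sign}(x)\in\{-1,0,1\}$. Underlying model: the latent value is $\theta\sim N(\mu,\tau^{-1})$ under the public belief. The seller's and buyer's agents observe $s=\theta+\varepsilon^S$ and $b=\theta+\varepsilon^B$, where $\varepsilon^S,\varepsilon^B$ are independent of each other and of $\theta$ and are $N(0,\kappa^{-1})$ (symmetric private-signal precision). Their posterior means are $m^S=(\tau\mu+\kappa s)/(\tau+\kappa)$ and $m^B=(\tau\mu+\kappa b)/(\tau+\kappa)$. The seller posts price $p=m^S-\ell+a$ with extraction $a$; the buyer accepts iff $p\le m^B-\underline u-\chi r$, where $r\ge0$ is the trust distance. Trade therefore occurs iff $m^S-m^B\le h(a,r)$; here $m^S-m^B\sim N(0,\omega(\tau)^2)$, which gives the displayed formula for $D$. *)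

(* Defs.v *)
From HB Require Import structures.
From mathcomp Require Import all_boot all_order all_algebra.
From mathcomp Require Import all_classical all_reals all_analysis.

Set Implicit Arguments.
Unset Strict Implicit.
Unset Printing Implicit Defensive.

Import Order.TTheory GRing.Theory Num.Theory.
Import numFieldNormedType.Exports.

Local Open Scope classical_set_scope.
Local Open Scope ring_scope.

Definition Phi (R : realType) (x : R) : R := fine (normal_prob 0 1 `]-oo, x]).

(* X ~ N(m, 1/q): q is the precision, whereas normal_prob takes a standard
   deviation. *)
Definition normal_with_precision (d : measure_display) (T : measurableType d)
    (R : realType) (P : probability T R) (X : {RV P >-> R}) (m q : R) : Prop :=
  forall A, measurable A ->
    distribution P X A = normal_prob m (Num.sqrt q^-1) A.

(* Taking some of the sets equal to setT gives the product rule for every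
   subfamily. *)
Definition mutually_independent3 (d : measure_display) (T : measurableType d)
    (R : realType) (P : probability T R) (X Y Z : {RV P >-> R}) : Prop :=
  forall A B C, measurable A -> measurable B -> measurable C ->
    P (X @^-1` A `&` Y @^-1` B `&` Z @^-1` C) =
    (P (X @^-1` A) * P (Y @^-1` B) * P (Z @^-1` C))%E.

Definition gaussian_signal_model (d : measure_display) (T : measurableType d)
    (R : realType) (P : probability T R) (theta epsS epsB : {RV P >-> R})
    (mu tau kappa : R) : Prop :=
  [/\ normal_with_precision theta mu tau,
      normal_with_precision epsS 0 kappa,
      normal_with_precision epsB 0 kappa &
      mutually_independent3 theta epsS epsB].

(* E[theta | theta + eps = x] for theta ~ N(mu, 1/tau) and an independent
   eps ~ N(0, 1/kappa). *)
Definition posterior_mean (R : realType) (mu tau kappa x : R) : R :=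
  (tau * mu + kappa * x) / (tau + kappa).

Definition posted_price (R : realType) (ell a mS : R) : R := mS - ell + a.

Definition buyer_accepts (R : realType) (u chi r mB p : R) : bool :=
  p <= mB - u - chi * r.

Definition trade_event (R : realType) (T : Type) (theta epsS epsB : T -> R)
    (mu kappa ell u chi a r tau : R) : set T :=
  [set w | let mS := posterior_mean mu tau kappa (theta w + epsS w) in
           let mB := posterior_mean mu tau kappa (theta w + epsB w) in
           buyer_accepts u chi r mB (posted_price ell a mS)].

Definition trade_prob (d : measure_display) (T : measurableType d)
    (R : realType) (P : probability T R) (theta epsS epsB : {RV P >-> R})
    (mu kappa ell u chi a r tau : R) : R :=
  fine (P (trade_event theta epsS epsB mu kappa ell u chi a r tau)).

Definition hgap (R : realType) (ell u chi a r : R) : R := ell - u - a - chi * r.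

Definition omega (R : realType) (kappa tau : R) : R :=
  Num.sqrt (2 * kappa) / (tau + kappa).

(* Main.v *)
(* Trade occurs iff epsS - epsB <= h (tau + kappa) / kappa: theta and mu cancel
   in the difference of posterior means. The difference of two independent
   centered Gaussians of deviation s is a centered Gaussian of deviation
   sqrt 2 * s, by completing the square in the convolution integral, so the
   probability of trade is Phi (k (tau + kappa)) with k = h / sqrt (2 kappa).
   The map tau |-> k (tau + kappa) is affine of slope k, which has the sign of h,
   and Phi has a positive derivative: this gives the sign of the derivative and
   the three limits. *)
From HB Require Import structures.
Require Import Defs.
From mathcomp Require Import all_boot all_order all_algebra.
From mathcomp Require Import all_classical all_reals all_analysis.
From mathcomp Require Import measurable_realfun ring lra.

Import Order.TTheory GRing.Theory Num.Theory.
Import numFieldNormedType.Exports.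

Local Open Scope classical_set_scope.
Local Open Scope ring_scope.

(** * Normal laws on the line: densities and affine changes of variable *)

Section normal.
Context {R : realType}.
Implicit Types (m s x y z : R).
Local Notation mu := (@lebesgue_measure R).

(** The Radon-Nikodym derivative of [normal_prob m s] agrees almost everywhere with
    [normal_pdf m s], since both have the same integral over every measurable set. *)
Lemma ge0_integral_normal_prob m s (f : R -> \bar R) :
  measurable_fun setT f -> (forall x, (0 <= f x)%E) ->
  (\int[normal_prob m s]_x f x = \int[mu]_x (f x * (normal_pdf m s x)%:E))%E.
Proof.
move=> mf f0.
have dom := normal_prob_dominates m s.
rewrite -(Radon_Nikodym_SigmaFinite.change_of_variables dom f0 measurableT mf).
apply: ae_eq_integral => //.
- apply: emeasurable_funM => //.
  exact: measurable_int (Radon_Nikodym_SigmaFinite.f_integrable dom).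
- apply: emeasurable_funM => //; apply/measurable_EFinP.
  exact: measurable_normal_pdf.
- apply: ae_eqe_mul2l; apply: integral_ae_eq => //.
  + exact: Radon_Nikodym_SigmaFinite.f_integrable.
  + by apply/measurable_EFinP; exact: measurable_normal_pdf.
  + by move=> E _ mE; rewrite -Radon_Nikodym_SigmaFinite.f_integral.
Qed.

(** Serves both for rescaling ([a = 0]) and for translation ([k = 1]). *)
Lemma ge0_integral_affineNy (G : R -> R) k a b : 0 < k ->
  continuous G -> (forall x, 0 <= G x) ->
  (\int[mu]_(x in `]-oo, (k * b + a)%R]) (G x)%:E =
   \int[mu]_(x in `]-oo, b]) (k * G (k * x + a)%R)%:E)%E.
Proof.
move=> k0 cG G0; pose F x := k * x + a.
have dF x : is_derive x 1 F k.
  by apply: is_derive_eq; rewrite scaler1 addr0.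
have F'E : F^`()%classic = cst k.
  by apply/funext => x; rewrite derive1E; exact: derive_val.
have cF : continuous F.
  by move=> x; apply: differentiable_continuous; apply/derivable1_diffP.
rewrite (increasing_ge0_integration_by_substitutionNy (F := F)).
- by apply: eq_integral => x _; rewrite F'E /= mulrC.
- by move=> x y _ _ xy; rewrite /F ltrD2r ltr_pM2l.
- by rewrite F'E => x _; exact: cvg_cst.
- by rewrite F'E; exact: is_cvg_cst.
- by rewrite F'E; exact: cvg_cst.
- by split => [x _ //|]; apply: cvg_at_left_filter; exact: cF.
- apply: (cvg_comp _ _ _ (cvg_addrr_Ny a)).
  by apply: gt0_cvgMrNy => //; exact: cvg_id.
- exact: continuous_subspaceT.
- by move=> x _.
Qed.

Lemma normal_prob_affineNy s k a b : s != 0 -> 0 < k ->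
  normal_prob 0 s `]-oo, k * b + a] =
  (\int[mu]_(x in `]-oo, b]) (k * normal_pdf 0 s (k * x + a)%R)%:E)%E.
Proof.
move=> s0 k0; apply: ge0_integral_affineNy => //.
- exact: continuous_normal_pdf.
- by move=> x; exact: normal_pdf_ge0.
Qed.

Lemma normal_peakE s : 0 < s -> normal_peak s = (s * Num.sqrt (pi *+ 2))^-1.
Proof.
move=> s0; rewrite /normal_peak -mulrnAr sqrtrM ?sqr_ge0//.
by rewrite sqrtr_sqr gtr0_norm.
Qed.

(** Under the dilation by [s], the Jacobian cancels the factor [1 / s] of the peak, and [s ^+ 2]
    cancels in the exponent. *)
Lemma normal_probM s x : 0 < s -> fine (normal_prob 0 s `]-oo, s * x]) = Phi x.
Proof.
move=> s0; rewrite -[s * x]addr0 normal_prob_affineNy ?gt_eqF//.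
congr fine; apply: eq_integral => y _; congr EFin.
rewrite addr0 !normal_pdfE ?gt_eqF// mulrA; congr (_ * _).
  by rewrite !normal_peakE// mul1r invfM mulrA mulfV ?gt_eqF// mul1r.
rewrite /normal_fun !subr0 expr1n exprMn.
by congr expR; field; rewrite gt_eqF.
Qed.

(** * Difference of two independent centered Gaussians *)

(** Completing the square: [y^2 + (z + y)^2 = z^2 / 2 + 2 (y + z / 2)^2]. The right side is the
    density of the difference [z] times the conditional density of [y] given [z]. *)
Lemma normal_pdf_mul s y z : 0 < s ->
  normal_pdf 0 s y * normal_pdf 0 s (z + y) =
  normal_pdf 0 (Num.sqrt 2 * s) z * normal_pdf (- z / 2) (s / Num.sqrt 2) y.
Proof.
move=> s0; have r0 : 0 < Num.sqrt 2 :> R by rewrite sqrtr_gt0.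
have p0 : 0 < Num.sqrt (pi *+ 2) :> R by rewrite sqrtr_gt0 mulrn_wgt0 ?pi_gt0.
have r2 : Num.sqrt 2 ^+ 2 = 2 :> R by rewrite sqr_sqrtr.
rewrite !normal_pdfE ?mulf_neq0 ?invr_neq0 ?gt_eqF// mulrACA [RHS]mulrACA.
congr (_ * _).
  rewrite !normal_peakE ?mulr_gt0 ?invr_gt0//.
  by field; rewrite ?gt_eqF.
rewrite /normal_fun -!expRD !exprMn exprVn r2; congr expR; field.
by rewrite gt_eqF.
Qed.

Lemma measurable_sub_le c : measurable [set w : R * R | w.2 - w.1 <= c].
Proof.
have mf : measurable_fun setT (fun w : R * R => w.2 - w.1).
  by apply: measurable_funB; [exact: measurable_snd|exact: measurable_fst].
rewrite (_ : [set _ | _] = setT `&` (fun w : R * R => w.2 - w.1) @^-1` `]-oo, c]).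
  by apply: mf.
by rewrite setTI; apply/seteqP; split => w /=; rewrite in_itv.
Qed.

Lemma normal_prob_product_sub s c : 0 < s ->
  (normal_prob 0 s \x normal_prob 0 s)%E [set w : R * R | w.2 - w.1 <= c] =
  normal_prob 0 (Num.sqrt 2 * s) `]-oo, c].
Proof.
move=> s0; have s0' := lt0r_neq0 s0.
set A := [set w | _].
have mA : measurable A by exact: measurable_sub_le.
have xA y : xsection A y = `]-oo, c + y]%classic.
  by apply/seteqP; split=> x; rewrite /xsection/= inE /A/= in_itv/= lerBlDr.
rewrite /product_measure1 ge0_integral_normal_prob//; last first.
  exact: measurable_fun_xsection.
(* Density in the coordinates (first variable, difference). In these the domain [D] of the
   difference no longer depends on [y], so Tonelli can swap the integrals and the conditional
   density of [y] integrates to 1. *)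
pose f (w : R * R) : R := normal_pdf 0 s w.1 * normal_pdf 0 s (w.2 + w.1).
pose D : set R := `]-oo, c]%classic.
have mf : measurable_fun setT f.
  apply: measurable_funM.
    by apply: measurableT_comp; [exact: measurable_normal_pdf|exact: measurable_fst].
  apply: measurableT_comp; first exact: measurable_normal_pdf.
  by apply: measurable_funD; [exact: measurable_snd|exact: measurable_fst].
transitivity (\int[mu]_y \int[mu]_z (f (y, z) * \1_D z)%:E)%E.
  apply: eq_integral => y _ /=.
  (* Writing [c + y] as [1 * c + y] lets the substitution with slope 1 translate the section by
     [y]. *)
  rewrite xA -[c]mul1r normal_prob_affineNy// muleC integral_mkcond.
  rewrite -ge0_integralZl_EFin ?normal_pdf_ge0//.
  - apply: eq_integral => z _; rewrite epatch_indic /= -EFinM.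
    by rewrite !mul1r mulrA.
  - by move=> z _; apply: erestrict_ge0 => x _; rewrite mul1r lee_fin normal_pdf_ge0.
  - rewrite epatch_indic; apply: emeasurable_funM; last first.
      by apply/measurable_EFinP; exact: measurable_indic.
    apply/measurable_EFinP; apply: measurable_funM => //.
    by apply: measurableT_comp; [exact: measurable_normal_pdf|exact: measurable_funD].
transitivity (\int[mu]_z \int[mu]_y (f (y, z) * \1_D z)%:E)%E.
  have mg : measurable_fun setT (fun w : R * R => (f w * \1_D w.2)%:E).
    have mD : measurable_fun setT (\1_D : R -> R).
      by apply: measurable_indic; exact: measurable_itv.
    apply/measurable_EFinP; apply: measurable_funM => //.
    exact: (measurableT_comp mD measurable_snd).
  apply: (fubini_tonelli (fun w : measurableTypeR R * measurableTypeR R =>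
    (f w * \1_D w.2)%:E)); first exact: mg.
  by move=> x; rewrite lee_fin /f !mulr_ge0 ?normal_pdf_ge0.
rewrite /normal_prob [RHS]integral_mkcond; apply: eq_integral => z _.
rewrite epatch_indic/=.
under eq_integral do rewrite /f/= normal_pdf_mul// mulrAC EFinM.
rewrite ge0_integralZl_EFin//.
- by rewrite integral_normal_pdf mule1.
- by move=> x _; rewrite lee_fin normal_pdf_ge0.
- by apply/measurable_EFinP; exact: measurable_normal_pdf.
- by rewrite mulr_ge0 ?normal_pdf_ge0.
Qed.

(** By independence the joint law of [(X, Y)] agrees with the product of the marginals on
    rectangles, hence is the product measure. *)
Lemma probability_normal_sub d (T : measurableType d) (P : probability T R)
    (X Y : {RV P >-> R}) s c : 0 < s ->
  (forall A, measurable A -> distribution P X A = normal_prob 0 s A) ->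
  (forall A, measurable A -> distribution P Y A = normal_prob 0 s A) ->
  (forall A B, measurable A -> measurable B ->
    P (X @^-1` A `&` Y @^-1` B) = (P (X @^-1` A) * P (Y @^-1` B))%E) ->
  P [set w | Y w - X w <= c] = normal_prob 0 (Num.sqrt 2 * s) `]-oo, c].
Proof.
move=> s0 lawX lawY indep; rewrite -normal_prob_product_sub//.
(* normal_prob is a measure on measurableTypeR R, whose display differs from
   that of the canonical measurable structure of R. *)
pose W w : measurableTypeR R * measurableTypeR R := (X w, Y w).
have mW : measurable_fun setT W :=
  measurable_fun_pair (measurable_funPT X) (measurable_funPT Y).
pose W' : {mfun T >-> (measurableTypeR R * measurableTypeR R)%type} :=
  HB.pack W (isMeasurableFun.Build _ _ _ _ W mW).
apply/esym; apply: (product_measure_unique (m' := distribution P W')) => //.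
- move=> A B mA mB; transitivity (P (X @^-1` A) * P (Y @^-1` B))%E.
    exact: indep.
  by congr (_ * _)%E; [exact: lawX|exact: lawY].
- exact: measurable_sub_le.
Qed.

(** * The standard normal distribution function: derivative, limits, value at 0 *)

Lemma is_derive_Phi x : is_derive x 1 (@Phi R) (normal_pdf 0 1 x).
Proof.
(* The bound [x + 1] only makes [x] interior to the half-line on which the fundamental theorem of
   calculus is applied. *)
have xx1 : x < x + 1 by rewrite ltrDl.
have pdfx : {for x, continuous (normal_pdf (0 : R) 1)}.
  by apply: continuous_normal_pdf; exact: oner_neq0.
have pdfi : mu.-integrable `]-oo, x + 1] (EFin \o normal_pdf (0 : R) 1).
  by apply: (integrableS _ _ (@subsetT _ _)) => //; exact: integrable_normal_pdf.
have [dPhi PhiE] := continuous_FTC1 xx1 pdfi (ltNyr x) pdfx.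
by apply: DeriveDef; [exact: dPhi|rewrite -derive1E; exact: PhiE].
Qed.

(** [Phi] is the distribution function of the identity under the standard normal law, so the general
    limits of distribution functions apply to it. *)
Let idTR : measurableTypeR R -> R := idfun.

Let idRV : {RV (normal_prob (0 : R) 1) >-> R} :=
  HB.pack idTR (isMeasurableFun.Build _ _ _ _ idTR (@measurable_id _ _ setT)).

Lemma cvg_Phi_pinfty : Phi x @[x --> +oo] --> (1 : R).
Proof. by have /fine_cvgP[_] := cvg_cdfy1 idRV. Qed.

Lemma cvg_Phi_ninfty : Phi x @[x --> -oo] --> (0 : R).
Proof. by have /fine_cvgP[_] := cvg_cdfNy0 idRV. Qed.

Lemma Phi0 : Phi 0 = 2^-1 :> R.
Proof.
pose A : set R := `]-oo, 0]%classic.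
have mA : measurable A by exact: measurable_itv.
have sym : normal_prob 0 1 (~` A) = normal_prob 0 1 A.
  (* The complement is open at 0; adding this null endpoint makes it the exact mirror image of [A],
     and the density is even. *)
  rewrite /normal_prob setCitvl integral_itv_obnd_cbnd; last first.
    by apply/measurable_EFinP/measurable_funTS; exact: measurable_normal_pdf.
  rewrite ge0_integration_by_substitution0.
  - apply: eq_integral => x _; rewrite !normal_pdfE ?oner_neq0//.
    by rewrite /normal_fun !subr0 sqrrN.
  - by apply/measurable_EFinP; exact: measurable_normal_pdf.
  - by move=> x; rewrite lee_fin normal_pdf_ge0.
have fA : normal_prob (0 : R) 1 A \is a fin_num by exact: fin_num_measure.
have setCE : (normal_prob 0 1 (~` A) = 1 - normal_prob 0 1 A)%E.
  exact: probability_setC.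
move: setCE; rewrite sym -(fineK fA) -[1%E]/(1%:E) -EFinB => -[].
rewrite -/(Phi 0); lra.
Qed.

End normal.

(** * From the signal model to the trade probability and its behavior in [tau] *)

Lemma trade_probE (R : realType) (mu kappa ell u chi a r tau : R)
    (d : measure_display) (T : measurableType d) (P : probability T R)
    (theta epsS epsB : {RV P >-> R}) : 0 < kappa -> 0 < tau ->
  gaussian_signal_model theta epsS epsB mu tau kappa ->
  trade_prob theta epsS epsB mu kappa ell u chi a r tau =
  Phi (hgap ell u chi a r / omega kappa tau).
Proof.
move=> k0 t0 [_ lawS lawB indep].
set h := hgap ell u chi a r.
have tk0 : 0 < tau + kappa by rewrite addr_gt0.
have sk0 : 0 < Num.sqrt kappa^-1 by rewrite sqrtr_gt0 invr_gt0.
(* Standard deviation of [epsS - epsB]. *)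
pose s := Num.sqrt 2 * Num.sqrt kappa^-1.
have s0 : 0 < s by rewrite mulr_gt0// sqrtr_gt0.
have sE : s * Num.sqrt (2 * kappa) = 2.
  rewrite /s -!sqrtrM ?mulr_ge0 ?invr_ge0 ?ltW//.
  have -> : 2 / kappa * (2 * kappa) = 2 ^+ 2 by field; rewrite gt_eqF.
  by rewrite sqrtr_sqr ger0_norm.
have w0 : 0 < Num.sqrt (2 * kappa) by rewrite sqrtr_gt0 mulr_gt0.
have w2 : Num.sqrt (2 * kappa) ^+ 2 = 2 * kappa by rewrite sqr_sqrtr ?mulr_ge0 ?ltW.
have swE : s = Num.sqrt (2 * kappa) / kappa.
  apply: (mulIf (lt0r_neq0 w0)); rewrite sE mulrAC -expr2 w2.
  by rewrite mulfK// gt_eqF.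
have thrE : s * (h / omega kappa tau) = (tau + kappa) / kappa * h.
  by rewrite swE /omega; field; rewrite !gt_eqF.
have tradeE : trade_event theta epsS epsB mu kappa ell u chi a r tau =
    [set w | epsS w - epsB w <= s * (h / omega kappa tau)].
  apply/funext => w; congr is_true.
  rewrite /buyer_accepts /posted_price /= -subr_ge0 -[RHS]subr_ge0.
  (* Multiplied by [(tau + kappa) / kappa > 0], the slack in the buyer's inequality becomes the
     slack in the inequality on the noises. *)
  rewrite thrE -(pmulr_rge0 _ (divr_gt0 tk0 k0)); congr (0 <= _).
  by rewrite /h /hgap /posterior_mean; field; rewrite !gt_eqF.
rewrite /trade_prob tradeE.
rewrite (@probability_normal_sub _ _ _ P epsB epsS (Num.sqrt kappa^-1))//.
- exact: normal_probM.
- move=> A B mA mB.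
  (* The full set in the place of [theta] leaves the product rule for the two noises. *)
  have := indep setT B A measurableT mB mA.
  by rewrite !preimage_setT setTI probability_setT mul1e setIC muleC.
Qed.

Theorem proposition1 (R : realType) (mu kappa ell u chi : R)
    (kappa_gt0 : 0 < kappa) (ell_gt0 : 0 < ell) (u_gt0 : 0 < u)
    (d : measure_display) (T : R -> measurableType d)
    (P : forall tau : R, probability (T tau) R)
    (theta epsS epsB : forall tau : R, {RV (P tau) >-> R})
    (model : forall tau : R, 0 < tau ->
       gaussian_signal_model (theta tau) (epsS tau) (epsB tau) mu tau kappa)
    (D : R -> R -> R -> R)
    (D_def : forall a r tau : R, 0 <= a -> 0 <= r -> 0 < tau ->
       D a r tau = trade_prob (theta tau) (epsS tau) (epsB tau)
                     mu kappa ell u chi a r tau)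
    (a r : R) (a_ge0 : 0 <= a) (r_ge0 : 0 <= r) :
  [/\ forall tau : R, 0 < tau ->
        D a r tau = Phi (hgap ell u chi a r / omega kappa tau),
      forall tau : R, 0 < tau ->
        derivable (D a r) tau 1 /\
        Num.sg (derive1 (D a r) tau) = Num.sg (hgap ell u chi a r) &
      [/\ 0 < hgap ell u chi a r -> D a r tau @[tau --> +oo] --> (1 : R),
          hgap ell u chi a r = 0 -> D a r tau @[tau --> +oo] --> (2^-1 : R) &
          hgap ell u chi a r < 0 -> D a r tau @[tau --> +oo] --> (0 : R)]].
Proof.
set h := hgap ell u chi a r.
pose k := h / Num.sqrt (2 * kappa).
have w0 : 0 < Num.sqrt (2 * kappa) by rewrite sqrtr_gt0 mulr_gt0.
have DE (tau : R) : 0 < tau -> D a r tau = Phi (h / omega kappa tau).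
  by move=> t0; rewrite D_def//; apply: trade_probE => //; exact: model.
(* [D a r] is prescribed only for positive [tau], whereas [g] is smooth on the whole line.
   Derivative and limits are computed for [g] and transferred by equality near a positive point or
   near infinity. *)
pose g tau := Phi (k * (tau + kappa)).
have Dg (tau : R) : 0 < tau -> D a r tau = g tau.
  move=> t0; rewrite DE// /g /k /omega; congr Phi; field.
  by rewrite !gt_eqF ?addr_gt0.
have dg (tau : R) : is_derive tau 1 g (normal_pdf 0 1 (k * (tau + kappa)) * k).
  have dA : is_derive tau 1 (fun t => k * (t + kappa)) k.
    by apply: is_derive_eq; rewrite addr0 scaler1.
  apply: is_derive_eq; first exact: is_derive1_comp (is_derive_Phi _) dA.
  by [].
have cvgD l : g tau @[tau --> +oo] --> l -> D a r tau @[tau --> +oo] --> l.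
  apply: cvg_trans; apply: near_eq_cvg.
  by near=> tau; rewrite Dg.
have cvgA : (tau + kappa : R) @[tau --> +oo] --> +oo by exact: cvg_addrr.
split=> [//|tau t0|].
  have gD : {near tau, g =1 D a r}.
    near=> t; rewrite Dg//; near: t; exact: lt_nbhsr.
  split; first exact: near_eq_derivable gD _.
  rewrite derive1E -(near_eq_derive _ gD) derive_val sgrM.
  have pdf0 : 0 < normal_pdf 0 1 (k * (tau + kappa)).
    by rewrite normal_pdfE ?oner_neq0// mulr_gt0 ?normal_peak_gt0 ?oner_neq0 ?expR_gt0.
  have iw0 : 0 < (Num.sqrt (2 * kappa))^-1 by rewrite invr_gt0.
  by rewrite (gtr0_sg pdf0) mul1r /k sgrM (gtr0_sg iw0) mulr1.
split=> [h0|h0|h0]; apply: cvgD.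
- apply: cvg_comp cvg_Phi_pinfty; apply: gt0_cvgMry => //.
  by rewrite divr_gt0.
- rewrite /g /k h0 mul0r; under eq_fun do rewrite mul0r.
  by rewrite Phi0; exact: cvg_cst.
- apply: cvg_comp cvg_Phi_ninfty.
  (* Negation turns the negative slope [k] into the positive slope [- k], reducing to divergence to
     [+oo]. *)
  apply/cvgNry; rewrite (_ : - _ = fun tau => - k * (tau + kappa)); last first.
    by apply/funext => t; rewrite fctE mulNr.
  apply: gt0_cvgMry => //.
  by rewrite oppr_gt0 pmulr_llt0// invr_gt0.
Unshelve. all: by end_near.
Qed.
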